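(* For all integers $m,s\geq 1$ and $n\geq 0$, \[ \zeta(\{2\}^{m-1},3,\{2\}^{n},1,\{2\}^{s})=\zeta(\{2\}^{n+m+s+1})+\zeta(\{2\}^{s-1},3,\{2\}^{m-1},3,\{2\}^{n})+\zeta(\{2\}^{m-1},3,\{2\}^{s-1},3,\{2\}^{n}). \]
   Context: Multiple zeta values are the real numbers \[ \zeta(k_{1},\ldots,k_{d})=\sum_{0<n_{1}<\cdots<n_{d}}\frac{1}{n_{1}^{k_{1}}\cdots n_{d}^{k_{d}}} \] for positive integers $k_1,\ldots,k_d$ with $k_d\geq 2$ (note the ordering convention: the largest summation index $n_d$ carries the last exponent $k_d$). The notation $\{2\}^{r}$ in an argument list stands for $r$ consecutive entries equal to $2$ (the empty list if $r=0$). *)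

(* Defs.v *)
From mathcomp Require Import all_boot all_order all_algebra.
From mathcomp Require Import all_classical all_reals all_analysis.

Set Implicit Arguments.
Unset Strict Implicit.
Unset Printing Implicit Defensive.

Import Order.TTheory GRing.Theory Num.Theory.

Local Open Scope classical_set_scope.
Local Open Scope ring_scope.

(* [path ltn 0 n] is the chain 0 < n_1 < ... < n_d.  The terms are nonnegative,
   so the sum exists in [0, +oo].  It is finite when the last exponent is at
   least 2 and the others are positive; [mzv R k] is meant for such [k] only
   ([fine] sends a divergent sum to 0). *)
Definition mzv (R : realType) (k : seq nat) : R :=
  fine (\esum_(n in [set n : (size k).-tuple nat | path ltn 0%N n])
    (\prod_(i < size k) ((tnth n i)%:R ^+ nth 0%N k i)^-1)%:E).

(* Main.v *)
Require Import Defs.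
From mathcomp Require Import all_boot all_order all_algebra.
From mathcomp Require Import all_classical all_reals all_analysis.
From mathcomp Require Import ring lra zify.

(** Fix [m] and [s], let [n] vary, and put a formal variable [y] on the block
    of [n] twos, so that this block contributes the product of the factors
    [1 + y / j^2] over the integers [j] strictly between its two neighbours.
    At [y = - p^2] with [p] a positive integer this product becomes
    [k_p (a, d) = \prod_(a < j < d) (1 - p^2 / j^2)], a truncated sine product.
    The whole proof exploits how [k_p] varies with [p]
    ([sine_prod_contiguous]): with [sigma = p k_p + (p - 1) k_(p-1)] and
    [delta = k_(p-1) - k_p] one has
    [(d - a - 1) sigma = (a d - p (p - 1)) delta], and, letting [d] tend to
    infinity, [sigma = a delta].

    For a generating function [F] in [y] consider the combinations
    [p F (- p^2) + (p - 1) F (- (p - 1)^2)] and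
    [F (- (p - 1)^2) - F (- p^2)], called the node sum and the node difference.
    Write [Z (w)] for the generating function of a family [w] of zeta values,
    and [2^r] for a block of [r] twos.  The relation between [sigma] and [delta]
    and a summation by parts over the end of the variable block give:
    - the node sum of [Z (2^(m-1), 3, 2^n, 1, 2^s)] is the node sum of
      [Z (2^(n+m+s+1))] plus the node differences of
      [Z (2^(m-1), 3, 2^(s+n))] and [Z (2^(m+n), 1, 2^s)]
      ([node_sum_inter]);
    - the node sum of [Z (2^(m-1), 3, 2^(s-1), 3, 2^n)] is the node difference
      of [Z (2^(m-1), 3, 2^(s+n))], and likewise with [m] and [s] exchanged
      ([suffix_bound]).
    By the two-block duality
    [zeta (2^r, 1, 2^s) = zeta (2^(s-1), 3, 2^r)], which is proved by the same
    method ([node_sum_duality]), everything cancels: the discrepancy [X (y)]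
    between the two sides of the theorem satisfies
    [p X (- p^2) + (p - 1) X (- (p - 1)^2) = 0], hence vanishes at [- p^2] for
    every [p >= 1], by induction on [p].

    It remains to deduce [X = 0], although [y |-> \prod_j (1 + y / j^2)]
    vanishes at these points too.  For this, all sums are truncated to indices
    below [N].  Then [X] is a polynomial of degree at most [N - 2], determined
    by its values at the [N - 1] nodes [- p^2] with [0 < p < N], and Lagrange
    interpolation bounds each fixed coefficient of [X] by a constant times
    [\sum_p `|X (- p^2)|] ([coef_le_values]).  Truncation only spoils the
    relation [sigma = a delta] of the infinite products, and the resulting
    errors make [X (- p^2)] of order [h^3 / (p N)] at most, where [h] is the
    sum of [1 / j] over [j < N].  So the coefficients of [X] are of order [h^4 / N]
    ([coef_discrepancy]), and they tend to [0]; truncated sums along [N = 2^L]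
    converge to the multiple zeta values ([mhs_cvg]). *)

Set Implicit Arguments.
Unset Strict Implicit.
Unset Printing Implicit Defensive.

Import Order.TTheory GRing.Theory Num.Theory.
Import numFieldNormedType.Exports.

Local Open Scope classical_set_scope.
Local Open Scope ring_scope.

Section Truncated.
Variable R : realFieldType.
Implicit Types (k : seq nat) (a b d i j lo N p n m s : nat) (w : nat -> R).

(** * Truncated multiple harmonic sums *)

(** The truncation of the multiple zeta value to [lo < n_1 < ... < n_d < N].  The
    lower end is a parameter as well, so that a sum can be cut at any index. *)
Fixpoint mhs k lo N : R :=
  if k is e :: k' then \sum_(lo.+1 <= j < N) j%:R ^- e * mhs k' j N else 1.

Definition twos n lo N : R := mhs (nseq n 2%N) lo N.

Lemma exprVn_ge0 j e : 0 <= j%:R ^- e :> R.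
Proof. by rewrite invr_ge0 exprn_ge0. Qed.

Lemma mhs_ge0 k lo N : 0 <= mhs k lo N.
Proof.
elim: k lo => [|e k IH] lo /=; first exact: ler01.
by apply: sumr_ge0 => j _; rewrite mulr_ge0 ?exprVn_ge0.
Qed.

Lemma mhs_homo k lo : {homo mhs k lo : N N' / (N <= N')%N >-> N <= N'}.
Proof.
move=> N N' NN'; elim: k lo => [|e k IH] lo //=.
have ge0 i i' : 0 <= \sum_(i <= j < i') j%:R ^- e * mhs k j N'.
  by apply: sumr_ge0 => j _; rewrite mulr_ge0 ?mhs_ge0 ?exprVn_ge0.
case: (leqP lo.+1 N) => [loN|/ltnW Nlo]; last by rewrite big_geq.
rewrite [leRHS](big_cat_nat loN NN') /= -[leLHS]addr0 lerD //.
by apply: ler_sum => j _; rewrite ler_wpM2l ?exprVn_ge0.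
Qed.

Lemma exchange_chain lo N (F : nat -> nat -> R) :
  \sum_(lo.+1 <= a < N) \sum_(a.+1 <= d < N) F a d =
  \sum_(lo.+1 <= d < N) \sum_(lo.+1 <= a < d) F a d.
Proof.
under eq_big_nat => a /andP[loa _].
  rewrite (@big_nat_widenl _ _ _ _ lo.+1) ?(leqW loa) //. over.
rewrite (exchange_big_dep_nat xpredT) //=; apply: eq_big_nat => d /andP[_ dN].
by rewrite [RHS](@big_nat_widen _ _ _ _ _ N) // ltnW.
Qed.

(** Cut every chain at the index [a] that carries the exponent [e]. *)
Lemma mhs_cat k e k' lo N :
  mhs (k ++ e :: k') lo N =
  \sum_(lo.+1 <= a < N) mhs k lo a * a%:R ^- e * mhs k' a N.
Proof.
elim: k lo => [|e' k IH] lo /=.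
  by apply: eq_bigr => a _; rewrite mul1r.
under eq_bigr => j _ do rewrite IH mulr_sumr.
rewrite exchange_chain; apply: eq_bigr => d _.
by rewrite -mulrA mulr_suml; apply: eq_bigr => a _; rewrite !mulrA.
Qed.

Lemma mhs_recl e k lo N : (lo.+1 < N)%N ->
  mhs (e :: k) lo N =
  (lo.+1)%:R ^- e * mhs k lo.+1 N + mhs (e :: k) lo.+1 N.
Proof. by move=> loN /=; rewrite big_ltn. Qed.

Lemma mhs_geq e k lo N : (N <= lo.+1)%N -> mhs (e :: k) lo N = 0.
Proof. by move=> Nlo /=; rewrite big_geq. Qed.

(** * Uniform bounds *)

(** Telescoping, since [j + 1 <= 2 j] gives [1 / j^2 <= 2 / j - 2 / (j + 1)]. *)
Lemma sum_invX_le lo N e : (1 < e)%N ->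
  \sum_(lo.+1 <= j < N) j%:R ^- e <= 2 / lo.+1%:R :> R.
Proof.
move=> e2; case: (leqP N lo.+1) => [Nlo|loN]; first by rewrite big_geq ?divr_ge0.
have le j : (lo.+1 <= j < N)%N ->
    j%:R ^- e <= (- (2 / j.+1%:R)) - (- (2 / j%:R)) :> R.
  move=> /andP[lj _]; have j1 : 1 <= j%:R :> R by rewrite (ler_nat _ 1); lia.
  have j0 : 0 < j%:R :> R by apply: lt_le_trans j1.
  apply: (@le_trans _ _ (j%:R ^- 2)).
    by rewrite lef_pV2 ?posrE ?exprn_gt0 // ler_weXn2l.
  have -> : - (2 / j.+1%:R) - - (2 / j%:R) = 2 / (j%:R * (j%:R + 1)) :> R.
    by rewrite -natr1; field; rewrite !lt0r_neq0 // addr_gt0.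
  rewrite ler_pdivlMr ?mulr_gt0 ?addr_gt0 // mulrC ler_pdivrMr ?exprn_gt0 //.
  by rewrite expr2 -subr_ge0 (_ : _ - _ = j%:R * (j%:R - 1)) ?mulr_ge0 ?subr_ge0 //; ring.
apply: le_trans (ler_sum_nat le) _.
rewrite (telescope_sumr (fun j => - (2 / j%:R)) (ltnW loN)).
by rewrite opprK addrC lerBlDr lerDl divr_ge0.
Qed.

Lemma mhs_cons_le (C : R) e k lo N : (1 < e)%N ->
  (forall j, mhs k j N <= C) -> mhs (e :: k) lo N <= C * (2 / lo.+1%:R).
Proof.
move=> e2 kC; have C0 : 0 <= C by apply: le_trans (kC 0%N); apply: mhs_ge0.
apply: le_trans (ler_wpM2l C0 (sum_invX_le lo N e2)) => /=.
by rewrite mulr_sumr; apply: ler_sum => j _; rewrite mulrC ler_wpM2r ?exprVn_ge0.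
Qed.

Lemma two_div_le lo : 2 / lo.+1%:R <= 2 :> R.
Proof. by rewrite ler_pdivrMr ?ltr0n // ler_peMr // ler1n. Qed.

Lemma mhs_cat_le (C : R) k k' lo N : all (leq 2) k ->
  (forall j, mhs k' j N <= C) -> mhs (k ++ k') lo N <= 2 ^+ size k * C.
Proof.
move=> + kC; have C0 : 0 <= C by apply: le_trans (kC 0%N); apply: mhs_ge0.
elim: k lo => [|e k IH] lo /=; first by rewrite mul1r.
move=> /andP[e2 /IH{}IH].
apply: le_trans (mhs_cons_le lo e2 IH) _.
rewrite exprS mulrC -mulrA ler_wpM2r ?two_div_le //.
by rewrite mulr_ge0 ?exprn_ge0.
Qed.

Lemma mhs_le k lo N : all (leq 2) k -> mhs k lo N <= 2 ^+ size k.
Proof.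
move=> k2; rewrite -[k in mhs k]cats0 -[leRHS]mulr1.
exact: mhs_cat_le.
Qed.

(** An exponent [1] is harmless in front of a [2]: the sum over the larger index
    gains a factor [O (1 / j)], which turns [1 / j] into [1 / j^2]. *)
Lemma mhs_one_twos_le s lo N :
  mhs (1%N :: nseq s.+1 2%N) lo N <= 2 ^+ s.+2.
Proof.
have s2 : all (leq 2) (nseq s 2%N) by rewrite all_nseq orbT.
apply: (@le_trans _ _ (2 ^+ s.+1 * (2 / lo.+1%:R))); last first.
  by rewrite [leRHS]exprSr ler_wpM2l ?exprn_ge0 ?two_div_le.
apply: le_trans (ler_wpM2l _ (sum_invX_le lo N (leqnn 2))); last by rewrite exprn_ge0.
rewrite mulr_sumr; apply: ler_sum_nat => j /andP[lj _].
have j0 : 0 < j%:R :> R by rewrite ltr0n; lia.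
apply: (@le_trans _ _ (j%:R ^- 1 * (2 ^+ s * (2 / j.+1%:R)))).
  rewrite ler_wpM2l ?exprVn_ge0 //; apply: mhs_cons_le => // i.
  by have := mhs_le i N s2; rewrite size_nseq.
have -> : 2 ^+ s.+1 * j%:R ^- 2 = 2 ^+ s * 2 * j%:R^-1 * j%:R^-1 :> R.
  by rewrite exprSr; field; rewrite lt0r_neq0.
have -> : j%:R ^- 1 * (2 ^+ s * (2 / j.+1%:R)) = 2 ^+ s * 2 * j%:R^-1 * j.+1%:R^-1 :> R.
  by rewrite expr1; ring.
apply: ler_wpM2l; first by rewrite mulr_ge0 ?invr_ge0 // mulr_ge0 // exprn_ge0.
by rewrite lef_pV2 ?posrE ?ltr0n ?ler_nat //; lia.
Qed.

Lemma twos_le n lo N : twos n lo N <= 2 ^+ n.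
Proof.
by have := @mhs_le (nseq n 2%N) lo N; rewrite size_nseq; apply; rewrite all_nseq orbT.
Qed.

(** * Blocks of twos and truncated sine products *)

Definition twos_gen a b : {poly R} :=
  \prod_(a.+1 <= j < b) (1 + j%:R ^- 2 *: 'X).

Lemma coef_linear_mul (x : R) (P : {poly R}) n :
  ((1 + x *: 'X) * P)`_n = P`_n + (if n is n'.+1 then x * P`_n' else 0).
Proof.
rewrite mulrDl mul1r coefD -scalerAl coefZ coefXM.
by case: n => [|n] //=; rewrite mulr0.
Qed.

Lemma coef_twos_gen a b n : (twos_gen a b)`_n = twos n a b.
Proof.
have [r Er] := ubnP (b - a); elim: r => // r IH in a n Er *.
case: (ltnP a.+1 b) => ab; last first.
  rewrite /twos_gen big_geq // coefC; case: n => [|n] //=.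
  by rewrite /twos mhs_geq.
rewrite /twos_gen big_ltn // coef_linear_mul -/(twos_gen a.+1 b).
rewrite IH; last by lia.
case: n => [|n]; first by rewrite addr0.
rewrite IH; last by lia.
by rewrite /twos /= -/(mhs (2%N :: nseq n 2%N) a b) mhs_recl // addrC.
Qed.

Lemma size_twos_gen a b : (size (twos_gen a b) <= (b - a.+1).+1)%N.
Proof.
rewrite /twos_gen; have [r Er] := ubnP (b - a); elim: r => // r IH in a Er *.
case: (ltnP a.+1 b) => ab; last by rewrite big_geq // size_poly1; lia.
rewrite big_ltn //; apply: leq_trans (size_polyMleq _ _) _.
have s1 : (size (1 + (a.+1)%:R ^- 2 *: 'X : {poly R})%R <= 2)%N.
  apply: leq_trans (size_polyD _ _) _; rewrite geq_max size_poly1 /=.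
  by apply: leq_trans (size_scale_leq _ _) _; rewrite size_polyX.
have s2 : (size (\prod_(a.+2 <= j < b) (1 + j%:R ^- 2 *: 'X) : {poly R})%R
            <= (b - a.+2).+1)%N by apply: IH; lia.
by lia.
Qed.

(** At [a = 0], in the limit of large [b], this is [sin (pi p) / (pi p)]. *)
Definition sine_prod p a b : R := \prod_(a.+1 <= j < b) (1 - p%:R ^+ 2 / j%:R ^+ 2).

Lemma horner_twos_gen p a b : (twos_gen a b).[- p%:R ^+ 2] = sine_prod p a b.
Proof.
rewrite /twos_gen horner_prod; apply: eq_bigr => j _.
by rewrite !hornerE /=; ring.
Qed.

Lemma sine_prod_recr p a b : (a < b)%N ->
  sine_prod p a b.+1 = sine_prod p a b * (1 - p%:R ^+ 2 / b%:R ^+ 2).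
Proof. by move=> ab; rewrite /sine_prod big_nat_recr. Qed.

Lemma sine_prod_recl p a b : (a.+1 < b)%N ->
  sine_prod p a b = (1 - p%:R ^+ 2 / (a.+1)%:R ^+ 2) * sine_prod p a.+1 b.
Proof. by move=> ab; rewrite /sine_prod big_ltn. Qed.

Lemma sine_prod1 p a : sine_prod p a a.+1 = 1.
Proof. by rewrite /sine_prod big_geq. Qed.

(** Both sides are essentially the product of the quotients
    [(j - p) (j + p) / j^2] over a range that is shifted by one in each linear
    factor, so only end terms differ. *)
Lemma sine_prod_contiguous p a d : (a < d)%N ->
  sine_prod p.+1 a d * ((d%:R - p%:R - 1) * (a%:R + p%:R + 1)) =
  sine_prod p a d * ((d%:R + p%:R) * (a%:R - p%:R)).
Proof.
elim: d => // d IH; rewrite ltnS leq_eqVlt => /orP[/eqP<-|ad].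
  by rewrite !sine_prod1 -natr1; ring.
have d0 : d%:R != 0 :> R by rewrite pnatr_eq0; lia.
rewrite !sine_prod_recr // -natr1 -[d.+1%:R]natr1.
have -> : sine_prod p.+1 a d * (1 - (p%:R + 1) ^+ 2 / d%:R ^+ 2) *
    ((d%:R + 1 - p%:R - 1) * (a%:R + p%:R + 1)) =
    (sine_prod p.+1 a d * ((d%:R - p%:R - 1) * (a%:R + p%:R + 1))) *
    ((d%:R + p%:R + 1) * (d%:R - p%:R) / d%:R ^+ 2) by field.
by rewrite IH //; field.
Qed.

Definition sine_sum p a d : R := p.+1%:R * sine_prod p.+1 a d + p%:R * sine_prod p a d.
Definition sine_diff p a d : R := sine_prod p a d - sine_prod p.+1 a d.

(** The engine of the proof: [sine_sum] and [sine_diff] are both combinations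
    of two products whose ratio is rational in [a], [d] and [p]. *)
Lemma sine_sum_diff p a d : (a < d)%N ->
  (d%:R - a%:R - 1) * sine_sum p a d = (a%:R * d%:R - p%:R * (p%:R + 1)) * sine_diff p a d.
Proof.
move=> /(sine_prod_contiguous p); rewrite /sine_sum /sine_diff -natr1 => E.
apply/eqP; rewrite -subr_eq0; apply/eqP.
transitivity (sine_prod p.+1 a d * ((d%:R - p%:R - 1) * (a%:R + p%:R + 1))
  - sine_prod p a d * ((d%:R + p%:R) * (a%:R - p%:R))); first by ring.
by rewrite E subrr.
Qed.

(** As [d] tends to infinity this says [sine_sum = a * sine_diff]; the right-hand
    side is the error at finite [d]. *)
Lemma sine_sum_defect p a d : (a < d)%N ->
  (d%:R + p%:R) * (sine_sum p a d - a%:R * sine_diff p a d) =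
  (2 * p%:R + 1) * (a%:R + p%:R + 1) * sine_prod p.+1 a d.
Proof.
move=> /(sine_prod_contiguous p); rewrite /sine_sum /sine_diff -natr1 => E.
transitivity ((p%:R + 1 + a%:R) * (d%:R + p%:R) * sine_prod p.+1 a d
  - sine_prod p a d * ((d%:R + p%:R) * (a%:R - p%:R))); first by ring.
by rewrite -E; ring.
Qed.

Lemma sine_diff1 p a : sine_diff p a a.+1 = 0.
Proof. by rewrite /sine_diff !sine_prod1 subrr. Qed.

Lemma sine_diff_step p a d : (a < d)%N ->
  d%:R ^+ 2 * (sine_diff p a d.+1 - sine_diff p a d) =
  sine_sum p a d - p%:R * (p%:R + 1) * sine_diff p a d.
Proof.
move=> ad; have d0 : d%:R != 0 :> R by rewrite pnatr_eq0; lia.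
by rewrite /sine_diff /sine_sum !sine_prod_recr // -natr1; field.
Qed.

(** * Summation by parts over the end of a block *)

Lemma sum_by_parts (f g : nat -> R) a N : (a < N)%N -> f a.+1 = 0 -> g N.-1 = 0 ->
  \sum_(a.+1 <= d < N) (f d.+1 - f d) * g d =
  \sum_(a.+1 <= d < N) f d * (g d.-1 - g d).
Proof.
case: N => // N; rewrite ltnS /= => aN f0 g0; apply/eqP; rewrite -subr_eq0.
rewrite -sumrB.
under eq_big_nat => d /andP[ad _].
  have -> : (f d.+1 - f d) * g d - f d * (g d.-1 - g d)
     = f d.+1 * g d.+1.-1 - f d * g d.-1 by rewrite /=; ring.
  over.
by rewrite telescope_sumr // /= g0 f0 mulr0 mul0r subrr.
Qed.

Lemma twos_step s d N : (0 < d < N)%N ->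
  d%:R ^- 2 * twos s d N = twos s.+1 d.-1 N - twos s.+1 d N.
Proof.
case: d => // d /= dN; rewrite /twos /=.
by rewrite -!/(mhs (2%N :: nseq s 2%N) _ N) mhs_recl // addrK.
Qed.

(** By [sine_sum_diff] and [sine_diff_step],
    [sigma / d = a delta / d + a sigma / d^2 + (delta (d + 1) - delta (d))], and the
    last term is summed by parts against the tail [twos s.+1 d N], whose
    differences are [d^-2 * twos s d N].  No boundary term survives. *)
Lemma sum_sine_sum_by_parts p a s N : (a < N)%N ->
  \sum_(a.+1 <= d < N) sine_sum p a d * (d%:R ^- 1 * twos s.+1 d N) =
  a%:R * (\sum_(a.+1 <= d < N) sine_diff p a d * (d%:R ^- 1 * twos s.+1 d N))
  + a%:R * (\sum_(a.+1 <= d < N) sine_sum p a d * (d%:R ^- 2 * twos s.+1 d N))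
  + \sum_(a.+1 <= d < N) sine_diff p a d * (d%:R ^- 2 * twos s d N).
Proof.
move=> aN.
have -> : \sum_(a.+1 <= d < N) sine_diff p a d * (d%:R ^- 2 * twos s d N) =
   \sum_(a.+1 <= d < N) (sine_diff p a d.+1 - sine_diff p a d) * twos s.+1 d N.
  rewrite sum_by_parts // ?sine_diff1 //; last by rewrite /twos mhs_geq //; lia.
  by apply: eq_big_nat => d ?; rewrite twos_step //; lia.
rewrite !mulr_sumr -!big_split /=; apply: eq_big_nat => d /andP[ad dN].
have d0 : d%:R != 0 :> R by rewrite pnatr_eq0; lia.
have E := sine_sum_diff p ad.
have -> : sine_diff p a d.+1 - sine_diff p a d =
    (sine_sum p a d - p%:R * (p%:R + 1) * sine_diff p a d) / d%:R ^+ 2.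
  by rewrite -sine_diff_step //; field.
rewrite expr1; apply/eqP; rewrite -subr_eq0; apply/eqP.
transitivity (((d%:R - a%:R - 1) * sine_sum p a d -
   (a%:R * d%:R - p%:R * (p%:R + 1)) * sine_diff p a d) / d%:R ^+ 2 * twos s.+1 d N).
  by field.
by rewrite E subrr !mul0r.
Qed.

(** * Sine products at integers below N *)

(** The factor [j = p] vanishes. *)
Lemma sine_prod_eq0 p a N : (a < p < N)%N -> sine_prod p a N = 0.
Proof.
move=> /andP[ap pN]; rewrite /sine_prod (big_cat_nat (n := p)) ?(ltnW pN) //=.
rewrite [X in _ * X]big_ltn // divff ?subrr ?mul0r ?mulr0 //.
by rewrite expf_neq0 // pnatr_eq0; lia.
Qed.

Lemma sine_prod_ge0 p a N : (p < N)%N -> 0 <= sine_prod p a N.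
Proof.
move=> pN; case: (ltnP a p) => ap; first by rewrite sine_prod_eq0 ?ap.
rewrite /sine_prod big_nat_cond; apply: prodr_ge0 => j; rewrite andbT => /andP[aj _].
rewrite subr_ge0 ler_pdivrMr ?mul1r ?exprn_gt0 ?ltr0n //; last by lia.
by rewrite ler_pXn2r ?nnegrE ?ler_nat //; lia.
Qed.

(** [p^2 b^-2 k_p (b, N)] is the difference of the values of [k_p (., N)] at [b] and
    [b - 1], and [k_p (0, N) = 0]. *)
Lemma sum_sine_prod p N : (0 < p < N)%N ->
  \sum_(1 <= b < N) b%:R ^- 2 * sine_prod p b N = p%:R ^- 2.
Proof.
move=> /andP[p0 pN]; have p0' : p%:R != 0 :> R by rewrite pnatr_eq0; lia.
apply: (mulfI (expf_neq0 2 p0')); rewrite divff ?expf_neq0 // mulr_sumr.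
under eq_big_nat => b /andP[b0 bN].
  have b0' : b%:R != 0 :> R by rewrite pnatr_eq0; lia.
  have -> : p%:R ^+ 2 * (b%:R ^- 2 * sine_prod p b N) = sine_prod p b.+1.-1 N - sine_prod p b.-1 N.
    case: b b0 bN b0' => // b _ bN b0'; rewrite /= (sine_prod_recl _ bN).
    by move: (b.+1%:R) b0' => B b0'; field.
  over.
rewrite telescope_sumr /=; last by lia.
case: N pN => // N pN; rewrite /= sine_prod1 sine_prod_eq0 ?subr0 //; lia.
Qed.

(** * Generating polynomials whose variable block comes last *)

(** For [w = mhs k 0], the coefficient of [y^n] is the sum for [k], then [i], then
    [n] twos; see [coef_suffix_poly]. *)
Definition suffix_poly i w N : {poly R} :=
  \sum_(1 <= b < N) (w b * b%:R ^- i) *: twos_gen b N.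

(** Node sums and differences at the consecutive nodes [- p^2] and
    [- p.+1 ^ 2]; [p.+1] here plays the role of [p] in the overview above. *)
Definition node_sum p (P : {poly R}) : R :=
  p.+1%:R * P.[- p.+1%:R ^+ 2] + p%:R * P.[- p%:R ^+ 2].
Definition node_diff p (P : {poly R}) : R :=
  P.[- p%:R ^+ 2] - P.[- p.+1%:R ^+ 2].

Lemma node_sum_suffix p i w N : node_sum p (suffix_poly i w N) =
  \sum_(1 <= b < N) w b * b%:R ^- i * sine_sum p b N.
Proof.
rewrite /node_sum /suffix_poly !horner_sum !mulr_sumr -big_split /=.
apply: eq_bigr => b _; rewrite !hornerZ !horner_twos_gen /sine_sum; ring.
Qed.

Lemma node_diff_suffix p i w N : node_diff p (suffix_poly i w N) =
  \sum_(1 <= b < N) w b * b%:R ^- i * sine_diff p b N.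
Proof.
rewrite /node_diff /suffix_poly !horner_sum -sumrB.
apply: eq_bigr => b _; rewrite !hornerZ !horner_twos_gen /sine_diff; ring.
Qed.

(** Term by term, the defect of [sine_sum = b * sine_diff] is at most
    [4 p.+1 / N * b^-2 * k_(p.+1) (b, N)] times [C], because the product vanishes for
    [b < p.+1]; and these terms have an explicit sum, [sum_sine_prod]. *)
Lemma suffix_bound (C : R) w p N : (forall b, 0 <= w b <= C) -> (p.+1 < N)%N ->
  `|node_sum p (suffix_poly 3 w N) - node_diff p (suffix_poly 2 w N)|
    <= 4 * C / (p.+1%:R * N%:R).
Proof.
move=> wC pN; have N0 : 0 < N%:R :> R by rewrite ltr0n; lia.
have P0 : 0 < p.+1%:R :> R by rewrite ltr0n.
have p0 : 0 <= p%:R :> R by [].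
have C0 : 0 <= C by case/andP: (wC 0%N) => /le_trans; apply.
rewrite node_sum_suffix node_diff_suffix -sumrB.
have -> : 4 * C / (p.+1%:R * N%:R) =
  \sum_(1 <= b < N) 4 * C * p.+1%:R / N%:R * (b%:R ^- 2 * sine_prod p.+1 b N).
  rewrite -mulr_sumr sum_sine_prod ?pN //; move: (p.+1%:R) P0 => P P0.
  by field; rewrite !lt0r_neq0.
apply: le_trans (ler_norm_sum _ _ _) _; apply: ler_sum_nat => b /andP[b0 bN].
have B0 : 0 < b%:R :> R by rewrite ltr0n.
have D0 : 0 < N%:R + p%:R :> R by rewrite ltr_wpDr.
have := sine_sum_defect p bN.
set u := sine_sum p b N; set v := sine_diff p b N => E.
have -> : w b * b%:R ^- 3 * u - w b * b%:R ^- 2 * v =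
   w b * (2 * p%:R + 1) * (b%:R + p%:R + 1) * b%:R ^- 3 / (N%:R + p%:R) * sine_prod p.+1 b N.
  transitivity (w b * b%:R ^- 3 / (N%:R + p%:R) * ((N%:R + p%:R) * (u - b%:R * v))).
    by field; rewrite !lt0r_neq0.
  by rewrite E; ring.
(* For [b >= p.+1] one has [b + p + 1 <= 2 b] and [2 p + 1 <= 2 p.+1]. *)
case: (ltnP b p.+1) => bp; first by rewrite sine_prod_eq0 ?bp // !mulr0 normr0.
have k0 : 0 <= sine_prod p.+1 b N by apply: sine_prod_ge0.
have /andP[w0 w1] := wC b.
have bp' : p%:R + 1 <= b%:R :> R by rewrite natr1 ler_nat.
rewrite ger0_norm; last first.
  rewrite mulr_ge0 // mulr_ge0 ?invr_ge0 ?(ltW D0) // mulr_ge0 ?exprVn_ge0 //.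
  by rewrite !mulr_ge0 // !addr_ge0 // mulr_ge0.
rewrite mulrA ler_wpM2r // -[p.+1%:R]natr1.
rewrite ler_pdivrMr //.
have -> : 4 * C * (p%:R + 1) / N%:R / b%:R ^+ 2 * (N%:R + p%:R) =
  (C * (2 * (p%:R + 1)) * (2 * b%:R)) * b%:R ^- 3 * ((N%:R + p%:R) / N%:R).
  by field; rewrite !lt0r_neq0.
rewrite -[leLHS]mulr1; apply: ler_pM.
- by rewrite mulr_ge0 ?exprVn_ge0 // !mulr_ge0 // !addr_ge0 // mulr_ge0.
- by [].
- rewrite ler_wpM2r ?exprVn_ge0 //; apply: ler_pM.
  + by rewrite mulr_ge0 // addr_ge0 // mulr_ge0.
  + by rewrite !addr_ge0 // ltW.
  + by apply: ler_pM => //; lra.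
  + by lra.
- by rewrite ler_pdivlMr // mul1r lerDl.
Qed.

(** * Lagrange interpolation at the points - p^2 *)

Lemma fact_sq_le p M : (p <= M)%N -> (M`! ^ 2 <= (M + p)`! * (M - p)`!)%N.
Proof.
elim: p => [|p IH] pM; first by rewrite addn0 subn0.
apply: leq_trans (IH (ltnW pM)) _.
rewrite addnS factS -(ltn_predK (n := M - p) (m := 0)); last by lia.
rewrite factS (_ : (M - p).-1 = (M - p.+1))%N; last by lia.
rewrite mulnCA mulnA leq_mul2r; apply/orP; right.
by rewrite leq_mul2r; apply/orP; right; lia.
Qed.

(** The factors below the node: [p^2 - j^2 = (p - j) (p + j)] gives factorials. *)
Lemma node_prod_lower p i : (0 < i <= p)%N ->
  (\prod_(1 <= j < i) `|1 - p%:R ^+ 2 / j%:R ^+ 2|) *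
    (i.-1`! ^ 2 * p * (p - i)`!)%:R = ((p + i).-1)`!%:R :> R.
Proof.
case: i => // i /=; elim: i => [|i IH] ip.
  rewrite big_geq // mul1r fact0 exp1n mul1n addn1 /=.
  by rewrite -[in RHS](ltn_predK ip) factS (ltn_predK ip) subn1.
rewrite big_nat_recr //= !addnS /= factS.
have := IH (ltnW ip); rewrite !addnS /= => {}IH.
have i0 : 0 < i.+1%:R :> R by rewrite ltr0n.
have -> : `|1 - p%:R ^+ 2 / i.+1%:R ^+ 2| =
   (p - i.+1)%:R * (p + i.+1)%:R / i.+1%:R ^+ 2 :> R.
  rewrite distrC ger0_norm; last first.
    by rewrite subr_ge0 ler_pdivlMr ?exprn_gt0 // mul1r ler_pXn2r ?nnegrE ?ler_nat // ltnW.
  rewrite natrB ?natrD; last by lia.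
  by move: (i.+1%:R : R) i0 => I I0; field; rewrite lt0r_neq0.
rewrite addnS [in RHS]factS [in RHS]natrM -IH.
have -> : (p - i.+1 = (p - i.+2).+1)%N by lia.
rewrite [in RHS]factS !natrM.
move: (i.+1%:R : R) i0 ((p - i.+2).+1%:R : R) ((p + i).+1%:R : R) => I I0 J L.
by field; rewrite lt0r_neq0.
Qed.

(** The denominator in the Lagrange basis, normalised so that its limit has
    absolute value [1 / 2]. *)
Definition node_prod p N : R :=
  \prod_(1 <= j < N | j != p) (1 - p%:R ^+ 2 / j%:R ^+ 2).

Lemma node_prodE p M : (0 < p <= M)%N ->
  `|node_prod p M.+1| * (2 * M`! ^ 2)%:R = ((M + p)`! * (M - p)`!)%:R.
Proof.
rewrite /node_prod normr_prod.
elim: M => [|M IH] /andP[p0 pM]; first by lia.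
move: pM; rewrite leq_eqVlt => /orP[/eqP Ep|pM].
  rewrite big_mkcond big_nat_recr //= -big_mkcond /= Ep eqxx mulr1 subnn fact0 muln1.
  have := @node_prod_lower M.+1 M.+1; rewrite leqnn => /(_ isT) /=.
  rewrite subnn fact0 muln1 => E.
  have -> : ((M.+1 + M.+1)`! = (M.+1 * 2) * (M.+1 + M.+1).-1`!)%N.
    by rewrite addnS /= factS; congr (_ * _)%N; lia.
  rewrite [in RHS]natrM -E !factS.
  rewrite big_nat_cond [X in _ = _ * (X * _)]big_nat_cond.
  under eq_bigl => j. rewrite (_ : _ && _ = (1 <= j < M.+1)%N && true); last by lia. over.
  by rewrite !natrM; ring.
have -> : \prod_(1 <= j < M.+2 | j != p) `|1 - p%:R ^+ 2 / j%:R ^+ 2| =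
    (\prod_(1 <= j < M.+1 | j != p) `|1 - p%:R ^+ 2 / j%:R ^+ 2|) *
    ((M.+1 + p)%:R * (M.+1 - p)%:R / M.+1%:R ^+ 2) :> R.
  rewrite big_mkcond big_nat_recr //= -big_mkcond /= (_ : M.+1 != p); last by lia.
  rewrite ger0_norm; last first.
    by rewrite subr_ge0 ler_pdivrMr ?exprn_gt0 // mul1r ler_pXn2r ?nnegrE ?ler_nat // ltnW.
  rewrite natrB ?natrD; last by lia.
  by move: (M.+1%:R : R) (ltr0Sn R M) => B B0; congr (_ * _); field; rewrite lt0r_neq0.
have := IH; rewrite p0 => /(_ pM) {}IH.
rewrite addSn subSn // 2!factS [RHS]natrM [(_ * (M + p)`!)%:R]natrM.
rewrite [(_ * (M - p)`!)%:R]natrM mulrACA -[_`!%:R * _]natrM -IH.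
rewrite !natrM.
by move: (M.+1%:R : R) (ltr0Sn R M) => B B0; field; rewrite lt0r_neq0.
Qed.

(** [(M + p)! (M - p)!] is smallest at [p = 0]. *)
Lemma node_prod_ge p N : (0 < p < N)%N -> 2^-1 <= `|node_prod p N|.
Proof.
case: N => [|M]; first by rewrite ltn0 andbF.
rewrite ltnS => pM; have := node_prodE pM; have /andP[_ /fact_sq_le] := pM.
rewrite -(ler_nat R) [(_ ^ 2)%:R]natrX => le E.
have F0 : 0 < (M`!%:R : R) by rewrite ltr0n fact_gt0.
rewrite -(ler_pM2r (x := (2 * M`! ^ 2)%:R)); last first.
  by rewrite ltr0n muln_gt0 expn_gt0 fact_gt0.
rewrite E; apply: le_trans le; rewrite natrM natrX mulrA mulVf ?mul1r ?pnatr_eq0 //.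
Qed.

Definition node_basis p N : {poly R} :=
  \prod_(1 <= j < N | j != p) (1 + j%:R ^- 2 *: 'X).

Lemma horner_node_basis p q N : (node_basis p N).[- q%:R ^+ 2] =
  \prod_(1 <= j < N | j != p) (1 - q%:R ^+ 2 / j%:R ^+ 2).
Proof.
rewrite /node_basis horner_prod; apply: eq_bigr => j _.
by rewrite !hornerE /=; ring.
Qed.

Lemma horner_node_basis_neq p q N : (0 < q < N)%N -> q != p ->
  (node_basis p N).[- q%:R ^+ 2] = 0.
Proof.
move=> qN qp; rewrite horner_node_basis -big_filter.
rewrite (bigD1_seq q) ?filter_uniq ?iota_uniq //=; last first.
  by rewrite mem_filter qp mem_index_iota.
by rewrite divff ?subrr ?mul0r // expf_neq0 // pnatr_eq0; lia.
Qed.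

Lemma twos_gen_basis p N : (0 < p < N)%N ->
  twos_gen 0 N = (1 + p%:R ^- 2 *: 'X) * node_basis p N.
Proof.
by move=> pN; rewrite /twos_gen (bigD1_seq p) ?iota_uniq ?mem_index_iota.
Qed.

Lemma coef_node_basis_ge0 p N n : 0 <= (node_basis p N)`_n.
Proof.
have [s ->] : exists s : seq nat, node_basis p N = \prod_(j <- s) (1 + j%:R ^- 2 *: 'X).
  by exists [seq j <- index_iota 1 N | j != p]; rewrite big_filter.
elim: s n => [|j s IH] n; first by rewrite big_nil coefC; case: ifP.
rewrite big_cons coef_linear_mul addr_ge0 //.
by case: n => // n; rewrite mulr_ge0 ?exprVn_ge0.
Qed.

(** The basis polynomial is a factor of [twos_gen 0 N] with complementary factor
    [1 + p^-2 y], and all coefficients are nonnegative. *)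
Lemma coef_node_basis_le p N n : (0 < p < N)%N ->
  (node_basis p N)`_n <= twos n 0 N.
Proof.
move=> pN; rewrite -coef_twos_gen (twos_gen_basis pN) coef_linear_mul lerDl.
by case: n => // n; rewrite mulr_ge0 ?exprVn_ge0 ?coef_node_basis_ge0.
Qed.

Lemma size_node_basis p N : (0 < p < N)%N -> (size (node_basis p N) <= N.-1)%N.
Proof.
move=> pN; have := size_twos_gen 0 N; rewrite (twos_gen_basis pN).
have s2 : size (1 + p%:R ^- 2 *: 'X : {poly R})%R = 2%N.
  have z : p%:R ^- 2 != 0 :> R.
    by rewrite invr_eq0 expf_eq0 /= pnatr_eq0; lia.
  by rewrite addrC size_polyDl size_scale ?size_polyX ?size_poly1.
have [-> //|nz] := eqVneq (node_basis p N) 0; first by rewrite size_poly0.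
rewrite size_mul // ?s2; last by rewrite -size_poly_eq0 s2.
move=> h; set z := size _ in h *; lia.
Qed.

Lemma lagrange_interpolation N (P : {poly R}) : (size P <= N.-1)%N ->
  P = \sum_(1 <= p < N) (P.[- p%:R ^+ 2] / node_prod p N) *: node_basis p N.
Proof.
move=> sP; apply/eqP; rewrite -subr_eq0; apply/eqP.
set Q := _ - _.
apply: (@roots_geq_poly_eq0 _ _ [seq - (p%:R : R) ^+ 2 | p <- index_iota 1 N]).
- apply/allP => _ /mapP[q qN ->]; rewrite mem_index_iota in qN.
  rewrite rootE /Q hornerD hornerN horner_sum.
  rewrite (bigD1_seq q) ?iota_uniq ?mem_index_iota //= hornerZ horner_node_basis.
  rewrite -/(node_prod q N) divfK; last first.
    by rewrite -normr_gt0; apply: lt_le_trans (node_prod_ge qN); rewrite invr_gt0.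
  rewrite big1_seq ?addr0 ?subrr // => p /andP[pq _].
  by rewrite hornerZ horner_node_basis_neq ?mulr0 // eq_sym.
- rewrite map_inj_in_uniq ?iota_uniq // => p q; rewrite !mem_index_iota => p0 q0.
  by move/oppr_inj/eqP; rewrite eqrXn2 // eqr_nat => /eqP.
- rewrite size_map size_iota subn1.
  apply: leq_trans (size_polyD _ _) _; rewrite geq_max sP size_polyN.
  apply: leq_trans (size_sum _ _ _) _; apply/bigmax_leqP_seq => p + _.
  rewrite mem_index_iota => pN.
  by apply: leq_trans (size_scale_leq _ _) (size_node_basis pN).
Qed.

(** The bound is uniform in [N]: both the Lagrange denominators and the
    coefficients of the basis polynomials are controlled independently of [N]. *)
Lemma coef_le_values (C : R) N (P : {poly R}) n :
  (size P <= N.-1)%N -> twos n 0 N <= C ->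
  `|P`_n| <= 2 * C * \sum_(1 <= p < N) `|P.[- p%:R ^+ 2]|.
Proof.
move=> sP nC; rewrite {1}(lagrange_interpolation sP) coef_sum mulr_sumr.
apply: le_trans (ler_norm_sum _ _ _) _; apply: ler_sum_nat => p pN.
rewrite coefZ normrM normf_div.
have c0 := coef_node_basis_ge0 p N n.
have w := node_prod_ge pN.
rewrite [`|(node_basis p N)`_n|]ger0_norm //.
rewrite -[leLHS]mulrA [leRHS]mulrC.
rewrite ler_wpM2l // ler_pM ?invr_ge0 //.
  by rewrite invf_ple ?posrE //; apply: lt_le_trans w; rewrite invr_gt0.
by apply: le_trans (coef_node_basis_le n pN) nC.
Qed.

(** * Generating polynomials whose variable block comes first or in between *)

(** The coefficient of [y^n] is the sum for [m] twos, [i], [n] twos, [j], [s] twos;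
    see [coef_inter_poly]. *)
Definition inter_poly i j m s N : {poly R} :=
  \sum_(1 <= a < N) \sum_(a.+1 <= d < N)
    (twos m 0 a * a%:R ^- i * (d%:R ^- j * twos s d N)) *: twos_gen a d.

(** The coefficient of [y^n] is the sum for [n] twos, [j], [s] twos; see
    [coef_prefix_poly]. *)
Definition prefix_poly j s N : {poly R} :=
  \sum_(1 <= d < N) (d%:R ^- j * twos s d N) *: twos_gen 0 d.

Lemma coef_suffix_poly i k N n :
  (suffix_poly i (mhs k 0) N)`_n = mhs (k ++ i :: nseq n 2%N) 0 N.
Proof.
rewrite mhs_cat coef_sum; apply: eq_bigr => b _.
by rewrite coefZ coef_twos_gen.
Qed.

Lemma coef_prefix_poly j s N n :
  (prefix_poly j s N)`_n = mhs (nseq n 2%N ++ j :: nseq s 2%N) 0 N.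
Proof.
rewrite mhs_cat coef_sum; apply: eq_bigr => b _.
by rewrite coefZ coef_twos_gen mulrC mulrA.
Qed.

Lemma coef_inter_poly i j m s N n :
  (inter_poly i j m s N)`_n =
  mhs (nseq m 2%N ++ i :: nseq n 2%N ++ j :: nseq s 2%N) 0 N.
Proof.
rewrite mhs_cat coef_sum; apply: eq_bigr => a _.
rewrite mhs_cat coef_sum mulr_sumr; apply: eq_bigr => d _.
by rewrite coefZ coef_twos_gen /twos; ring.
Qed.

Lemma node_sumB p (P Q : {poly R}) : node_sum p (P - Q) = node_sum p P - node_sum p Q.
Proof. by rewrite /node_sum !hornerE; ring. Qed.

Lemma node_diffB p (P Q : {poly R}) : node_diff p (P - Q) = node_diff p P - node_diff p Q.
Proof. by rewrite /node_diff !hornerE; ring. Qed.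

Lemma node_sum_sum p (I : Type) (r : seq I) (F : I -> {poly R}) :
  node_sum p (\sum_(i <- r) F i) = \sum_(i <- r) node_sum p (F i).
Proof. by rewrite /node_sum !horner_sum !mulr_sumr -big_split. Qed.

Lemma node_diff_sum p (I : Type) (r : seq I) (F : I -> {poly R}) :
  node_diff p (\sum_(i <- r) F i) = \sum_(i <- r) node_diff p (F i).
Proof. by rewrite /node_diff !horner_sum -sumrB. Qed.

Lemma node_sumZ p a d (x : R) : node_sum p (x *: twos_gen a d) = x * sine_sum p a d.
Proof. by rewrite /node_sum !hornerZ !horner_twos_gen /sine_sum; ring. Qed.

Lemma node_diffZ p a d (x : R) : node_diff p (x *: twos_gen a d) = x * sine_diff p a d.
Proof. by rewrite /node_diff !hornerZ !horner_twos_gen /sine_diff; ring. Qed.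

(** The case [a = 0] of [sum_sine_sum_by_parts]. *)
Lemma node_sum_prefix p s N : node_sum p (prefix_poly 1 s.+1 N) = node_diff p (prefix_poly 2 s N).
Proof.
rewrite /prefix_poly node_sum_sum node_diff_sum.
under eq_bigr do rewrite node_sumZ mulrC.
under [RHS]eq_bigr do rewrite node_diffZ mulrC.
case: N => [|N]; first by rewrite !big_geq.
by rewrite sum_sine_sum_by_parts // !mul0r !add0r.
Qed.

(** [sum_sine_sum_by_parts] for each position [a] of the exponent [3], weighted by
    [a^-3]: the factors [a] turn this exponent into [2] where they occur. *)
Lemma node_sum_inter p m s N : node_sum p (inter_poly 3 1 m s.+1 N) =
  node_diff p (inter_poly 2 1 m s.+1 N) + node_sum p (inter_poly 2 2 m s.+1 N)
  + node_diff p (inter_poly 3 2 m s N).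
Proof.
rewrite /inter_poly !node_sum_sum !node_diff_sum -!big_split /=.
apply: eq_big_nat => a /andP[a0 aN].
have a0' : a%:R != 0 :> R by rewrite pnatr_eq0; lia.
rewrite !node_sum_sum !node_diff_sum.
under eq_bigr do rewrite node_sumZ -mulrA [X in _ * X]mulrC.
under [X in _ = X + _ + _]eq_bigr do rewrite node_diffZ -mulrA [X in _ * X]mulrC.
under [X in _ = _ + X + _]eq_bigr do rewrite node_sumZ -mulrA [X in _ * X]mulrC.
under [X in _ = _ + _ + X]eq_bigr do rewrite node_diffZ -mulrA [X in _ * X]mulrC.
rewrite -!mulr_sumr sum_sine_sum_by_parts //; move: (twos m 0 a) => T.
move: (\sum_(a.+1 <= i < N) _) (\sum_(a.+1 <= i < N) _) (\sum_(a.+1 <= i < N) _).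
by move=> x y z; field.
Qed.

(** * From node sums to coefficients *)

Definition harm N : R := \sum_(1 <= j < N) j%:R^-1.

Lemma harm_ge0 N : 0 <= harm N.
Proof. by apply: sumr_ge0 => j _; rewrite invr_ge0. Qed.

Lemma harm_ge1 N : (1 < N)%N -> 1 <= harm N.
Proof.
by move=> N1; rewrite /harm big_ltn // invr1 lerDl sumr_ge0 // => j _; rewrite invr_ge0.
Qed.

(** Descent on [p]: consecutive values [p * P (- p^2)] cancel up to the given
    errors, whose sum is at most [eps * harm N]. *)
Lemma small_values (eps : R) N (P : {poly R}) :
  (forall p, (p.+1 < N)%N -> `|node_sum p P| <= eps / p.+1%:R) ->
  forall p, (0 < p < N)%N -> `|P.[- p%:R ^+ 2]| <= eps * harm N / p%:R.
Proof.
move=> small p /andP[p0 pN].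
have p0' : 0 < p%:R :> R by rewrite ltr0n.
have eps0 : 0 <= eps by have := le_trans (normr_ge0 _) (small 0%N (leq_ltn_trans p0 pN)); rewrite invr1 mulr1.
rewrite ler_pdivlMr // mulrC.
suff le : p%:R * `|P.[- p%:R ^+ 2]| <= eps * harm p.+1.
  apply: le_trans le _; rewrite ler_wpM2l // /harm [leRHS](@big_cat_nat _ _ _ p.+1) //=.
  by rewrite lerDl sumr_ge0 // => j _; rewrite invr_ge0.
elim: p pN {p0 p0'} => [|p IH] pN; first by rewrite mul0r mulr_ge0 ?harm_ge0.
have := IH (ltnW pN); have := small p pN.
have -> : harm p.+2 = harm p.+1 + p.+1%:R^-1.
  by rewrite /harm big_nat_recr.
rewrite mulrDr /node_sum; move: (P.[_]) (P.[_]) => y x.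
have <- : `|p.+1%:R * x| = p.+1%:R * `|x| by rewrite normrM ger0_norm.
have <- : `|p%:R * y| = p%:R * `|y| by rewrite normrM ger0_norm.
move=> lxy ly; have := ler_normB (p.+1%:R * x + p%:R * y) (p%:R * y).
rewrite addrK => /le_trans; apply; rewrite addrC; exact: lerD.
Qed.

Lemma small_coef (eps : R) N (P : {poly R}) n :
  (size P <= N.-1)%N ->
  (forall p, (p.+1 < N)%N -> `|node_sum p P| <= eps / p.+1%:R) ->
  `|P`_n| <= 2 * 2 ^+ n * (eps * harm N ^+ 2).
Proof.
move=> sP small; apply: le_trans (coef_le_values sP (twos_le n 0 N)) _.
apply: ler_wpM2l; first by rewrite mulr_ge0 // exprn_ge0.
apply: le_trans (ler_sum_nat (fun p pN => small_values small pN)) _.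
by rewrite -mulr_sumr -mulrA expr2.
Qed.

Lemma size_suffix_poly i w N : (size (suffix_poly i w N) <= N.-1)%N.
Proof.
apply: leq_trans (size_sum _ _ _) _; apply/bigmax_leqP_seq => b + _.
rewrite mem_index_iota => bN; apply: leq_trans (size_scale_leq _ _) _.
by apply: leq_trans (size_twos_gen _ _) _; lia.
Qed.

Lemma size_prefix_poly j s N : (size (prefix_poly j s N) <= N.-1)%N.
Proof.
apply: leq_trans (size_sum _ _ _) _; apply/bigmax_leqP_seq => b + _.
rewrite mem_index_iota => bN; apply: leq_trans (size_scale_leq _ _) _.
by apply: leq_trans (size_twos_gen _ _) _; lia.
Qed.

Lemma size_inter_poly i j m s N : (size (inter_poly i j m s N) <= N.-1)%N.
Proof.
apply: leq_trans (size_sum _ _ _) _; apply/bigmax_leqP_seq => a + _.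
rewrite mem_index_iota => aN.
apply: leq_trans (size_sum _ _ _) _; apply/bigmax_leqP_seq => b + _.
rewrite mem_index_iota => bN; apply: leq_trans (size_scale_leq _ _) _.
by apply: leq_trans (size_twos_gen _ _) _; lia.
Qed.

Lemma size_polyB_leq N (P Q : {poly R}) :
  (size P <= N)%N -> (size Q <= N)%N -> (size (P - Q)%R <= N)%N.
Proof.
by move=> sP sQ; apply: leq_trans (size_polyD _ _) _; rewrite size_polyN geq_max sP.
Qed.

(** * Two-block duality *)

Lemma nseq_cat_cons m n (x : nat) : nseq m x ++ x :: nseq n x = nseq (m + n.+1) x.
Proof. by rewrite -[x :: _]/(nseq n.+1 x) -nseqD. Qed.

(** The truncated defect of [zeta (2^r, 1, 2^s.+1) = zeta (2^s, 3, 2^r)], as a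
    generating polynomial in [r]. *)
Definition duality_poly s N : {poly R} :=
  prefix_poly 1 s.+1 N - suffix_poly 3 (mhs (nseq s 2%N) 0) N.

Lemma all_twos s : all (leq 2) (nseq s 2%N).
Proof. by rewrite all_nseq orbT. Qed.

(** The node difference produced by [node_sum_prefix] belongs to a single block
    of twos, where it does not matter which end of the block is variable; so it is
    also the one of [suffix_bound]. *)
Lemma node_sum_duality s p N : (p.+1 < N)%N ->
  `|node_sum p (duality_poly s N)| <= 4 * 2 ^+ s / N%:R / p.+1%:R.
Proof.
move=> pN; rewrite node_sumB node_sum_prefix.
(* Both polynomials generate the blocks of [n + s.+1] twos. *)
have -> : prefix_poly 2 s N = suffix_poly 2 (mhs (nseq s 2%N) 0) N.
  apply/polyP => n; rewrite coef_prefix_poly coef_suffix_poly.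
  by rewrite !nseq_cat_cons addnC addSnnS.
rewrite distrC; have H b : 0 <= mhs (nseq s 2%N) 0 b <= 2 ^+ s.
  by rewrite mhs_ge0 twos_le.
apply: le_trans (suffix_bound H pN) _.
by rewrite invfM [_^-1 * _^-1]mulrC mulrA.
Qed.

(** The same defect for [r = m.+1 + n], as a generating polynomial in [n]: the
    quotient of [duality_poly s N] by [y^(m.+1)], up to lower terms. *)
Definition duality_tail m s N : {poly R} :=
  inter_poly 2 1 m s.+1 N - suffix_poly 2 (mhs (nseq s 2%N ++ 3%N :: nseq m 2%N) 0) N.

Lemma coef_duality_tail m s N n :
  (duality_tail m s N)`_n = (duality_poly s N)`_(m.+1 + n).
Proof.
rewrite !coefB coef_inter_poly coef_prefix_poly !coef_suffix_poly.
by rewrite addSnnS -nseq_cat_cons -!catA.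
Qed.

Lemma duality_tail_split m s N :
  duality_poly s N = \poly_(i < m.+1) (duality_poly s N)`_i
                     + duality_tail m s N * 'X^(m.+1).
Proof.
apply/polyP => i; rewrite coefD coef_poly coefMXn.
case: ltnP => im; first by rewrite addr0.
by rewrite add0r coef_duality_tail subnKC.
Qed.

(** Dividing by [y^(m.+1)] only helps at a node, where [`|y| >= 1]; the low
    coefficients that have to be removed first are small by [small_coef]. *)
Lemma duality_tail_value m s : exists2 K : R, 0 <= K &
  forall N p, (1 < N)%N -> (p < N)%N ->
  `|(duality_tail m s N).[- p%:R ^+ 2]| <= K * harm N ^+ 2 / N%:R / p.+1%:R.
Proof.
pose S : R := 1 + \sum_(i < m.+2) 2 * 2 ^+ i.
have S1 : 0 <= S by rewrite addr_ge0 // sumr_ge0 // => i _; rewrite mulr_ge0 ?exprn_ge0.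
pose K : R := 4 * 2 ^+ s.
have K0 : 0 <= K by rewrite mulr_ge0 ?exprn_ge0.
exists (2 * K * S) => [|N p N1 pN]; first by apply: mulr_ge0 S1; apply: mulr_ge0 K0.
set D := duality_poly s N; set T := duality_tail m s N.
have h1 := harm_ge1 N1; set h := harm N in h1 *.
have N0 : 0 < N%:R :> R by rewrite ltr0n; lia.
have h0 : 0 <= h := le_trans ler01 h1.
have eps0 : 0 <= K / N%:R by apply: divr_ge0 => //; exact: ltW.
have eph0 : 0 <= K / N%:R * h ^+ 2 by apply: mulr_ge0 => //; exact: exprn_ge0.
have sD : (size D <= N.-1)%N.
  by rewrite size_polyB_leq ?size_prefix_poly ?size_suffix_poly.
have small q : (q.+1 < N)%N -> `|node_sum q D| <= K / N%:R / q.+1%:R.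
  exact: node_sum_duality.
have coefD i : `|D`_i| <= K / N%:R * h ^+ 2 * (2 * 2 ^+ i).
  by rewrite mulrC; exact: small_coef.
have coefS n : (n <= m.+2)%N -> \sum_(i < n) `|D`_i| <= K / N%:R * h ^+ 2 * (S - 1).
  move=> nm; rewrite /S [1 + \sum_(_ < _) _]addrC addrK mulr_sumr.
  apply: (@le_trans _ _ (\sum_(i < n) K / N%:R * h ^+ 2 * (2 * 2 ^+ i))).
    by apply: ler_sum.
  rewrite (big_ord_widen _ (fun i => K / N%:R * h ^+ 2 * (2 * 2 ^+ i)) nm).
  rewrite [leRHS](bigID (fun i : 'I_m.+2 => (i < n)%N)) /= lerDl sumr_ge0 // => i _.
  by apply: mulr_ge0 => //; rewrite ?mulr_ge0 ?exprn_ge0.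
have B0 : 0 <= K / N%:R * h ^+ 2 * S by apply: mulr_ge0.
have -> : 2 * K * S * h ^+ 2 / N%:R / p.+1%:R = K / N%:R * h ^+ 2 * S * (2 / p.+1%:R).
  by ring.
suff main : `|T.[- p%:R ^+ 2]| * (if p == 0%N then 1 else p%:R) <= K / N%:R * h ^+ 2 * S.
  case: p pN main => [|p] pN /= main.
    rewrite mulr1 in main; apply: le_trans main _; rewrite ler_peMr //.
    by rewrite divr1 ler1n.
  rewrite -ler_pdivlMr ?ltr0n // in main; apply: le_trans main _.
  apply: ler_wpM2l => //; rewrite ler_pdivlMr ?ltr0n // mulrC ler_pdivrMr ?ltr0n //.
  by rewrite -natrM ler_nat; lia.
case: p pN => [|p] pN /=.
  rewrite mulr1 expr0n /= oppr0 horner_coef0 coef_duality_tail addn0 -/D.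
  apply: le_trans (coefD _) _; apply: ler_wpM2l => //.
  by rewrite /S big_ord_recr /= addrA lerDr addr_ge0 ?sumr_ge0.
(* The value of the tail at [x] is recovered from that of [duality_poly] by
   removing the coefficients below [m.+1] and dividing by [x ^ m.+1]. *)
set x := - p.+1%:R ^+ 2.
have p1 : 1 <= p.+1%:R :> R by rewrite ler1n.
have nx : `|x| = p.+1%:R ^+ 2 by rewrite normrN ger0_norm ?exprn_ge0.
have x1 : 1 <= `|x| by rewrite nx exprn_ege1.
have E : T.[x] * x ^+ m.+1 = D.[x] - \sum_(i < m.+1) D`_i * x ^+ i.
  rewrite {1}/D (duality_tail_split m s N) hornerD horner_poly.
  by rewrite hornerM hornerXn [X in X - _]addrC addrK.
apply: (@le_trans _ _ (`|T.[x]| * `|x|)).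
  by rewrite ler_wpM2l // nx expr2 ler_peMl.
have xm : 0 < `|x| ^+ m by rewrite exprn_gt0 // (lt_le_trans _ x1).
rewrite -(ler_pM2r xm) -[leLHS]mulrA -exprS -normrX -normrM E.
apply: le_trans (ler_normB _ _) _.
have xm1 : 1 <= `|x| ^+ m by rewrite exprn_ege1.
have -> : S = 1 + (S - 1) by ring.
rewrite mulrDr mulrDl; apply: lerD.
  rewrite mulr1; apply: (@le_trans _ _ (K / N%:R * h ^+ 2)); last first.
    exact: ler_peMr.
  apply: le_trans (small_values small _) _; first by rewrite pN.
  rewrite -/h ler_pdivrMr ?ltr0n // -[leRHS]mulrA ler_wpM2l //.
  by rewrite expr2 -mulrA ler_peMr // mulr_ege1.
apply: le_trans (ler_norm_sum _ _ _) _.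
apply: (@le_trans _ _ (\sum_(i < m.+1) `|D`_i| * `|x| ^+ m)).
  apply: ler_sum => i _; rewrite normrM normrX ler_wpM2l // ler_weXn2l //.
  by rewrite -ltnS.
by rewrite -mulr_suml ler_wpM2r ?(ltW xm) // coefS.
Qed.

(** * The truncated identity *)

(** The node differences of [node_sum_inter] and of the two instances of
    [suffix_bound] combine to that of [duality_tail]; conclude by [small_coef]. *)
Lemma coef_discrepancy m s n : exists2 K : R, 0 <= K & forall N, (1 < N)%N ->
  `| mhs (nseq m 2%N ++ 3%N :: nseq n 2%N ++ 1%N :: nseq s.+1 2%N) 0 N
     - mhs (nseq m 2%N ++ 2%N :: nseq n 2%N ++ 2%N :: nseq s.+1 2%N) 0 N
     - mhs (nseq m 2%N ++ 3%N :: nseq s 2%N ++ 3%N :: nseq n 2%N) 0 N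
     - mhs (nseq s 2%N ++ 3%N :: nseq m 2%N ++ 3%N :: nseq n 2%N) 0 N |
  <= K * harm N ^+ 4 / N%:R.
Proof.
have [K K0 HK] := duality_tail_value m s.
pose C : R := 2 ^+ (m + s.+1).
have C0 : 0 <= C by rewrite exprn_ge0.
have bound i l : (i + l.+1 = m + s.+1)%N ->
    forall b, 0 <= mhs (nseq i 2%N ++ 3%N :: nseq l 2%N) 0 b <= C.
  move=> il b; rewrite mhs_ge0 /C -il.
  have := @mhs_le (nseq i 2%N ++ 3%N :: nseq l 2%N) 0 b.
  by rewrite size_cat /= !size_nseq; apply; rewrite all_cat /= !all_twos.
exists (2 * 2 ^+ n * (2 * K + 8 * C)) => [|N N1].
  by apply: mulr_ge0; [rewrite mulr_ge0 ?exprn_ge0 | rewrite addr_ge0 ?mulr_ge0].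
pose w := mhs (nseq m 2%N ++ 3%N :: nseq s 2%N) 0.
pose w' := mhs (nseq s 2%N ++ 3%N :: nseq m 2%N) 0.
(* The discrepancy, as a polynomial in the variable that records [n]. *)
pose X : {poly R} := inter_poly 3 1 m s.+1 N - inter_poly 2 2 m s.+1 N
  - suffix_poly 3 w N - suffix_poly 3 w' N.
have -> : mhs (nseq m 2%N ++ 3%N :: nseq n 2%N ++ 1%N :: nseq s.+1 2%N) 0 N
     - mhs (nseq m 2%N ++ 2%N :: nseq n 2%N ++ 2%N :: nseq s.+1 2%N) 0 N
     - mhs (nseq m 2%N ++ 3%N :: nseq s 2%N ++ 3%N :: nseq n 2%N) 0 N
     - mhs (nseq s 2%N ++ 3%N :: nseq m 2%N ++ 3%N :: nseq n 2%N) 0 N = X`_n.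
  by rewrite !coefB !coef_inter_poly !coef_suffix_poly -!catA.
have N0 : 0 < N%:R :> R by rewrite ltr0n; lia.
have h1 := harm_ge1 N1; set h := harm N in h1 *.
have h0 : 0 <= h := le_trans ler01 h1.
have hh1 : 1 <= h ^+ 2 by rewrite exprn_ege1.
have sX : (size X <= N.-1)%N.
  by rewrite !size_polyB_leq ?size_inter_poly ?size_suffix_poly.
have -> : 2 * 2 ^+ n * (2 * K + 8 * C) * h ^+ 4 / N%:R =
  2 * 2 ^+ n * ((2 * K + 8 * C) * h ^+ 2 / N%:R * h ^+ 2) by ring.
apply: small_coef => // p pN.
have E : node_sum p X = node_diff p (duality_tail m s N)
   - (node_sum p (suffix_poly 3 w N) - node_diff p (suffix_poly 2 w N))
   - (node_sum p (suffix_poly 3 w' N) - node_diff p (suffix_poly 2 w' N)).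
  rewrite /X !node_sumB node_sum_inter /duality_tail node_diffB -/w'.
  (* Both generate [m] twos, [3], [s + n.+1] twos. *)
  have -> : inter_poly 3 2 m s N = suffix_poly 2 w N.
    apply/polyP => i; rewrite coef_inter_poly coef_suffix_poly -catA /=.
    by rewrite !nseq_cat_cons addnC addSnnS.
  by ring.
have b1 := suffix_bound (bound m s erefl) pN.
have sm : (s + m.+1 = m + s.+1)%N by rewrite addnS addnC -addnS.
have b2 := suffix_bound (bound s m sm) pN.
rewrite E; apply: le_trans (ler_normB _ _) _.
apply: le_trans (lerD (ler_normB _ _) (lexx _)) _.
apply: le_trans (lerD (lerD (ler_normB _ _) b1) b2) _.
have p1 := HK N p.+1 N1 pN; have p2 := HK N p N1 (ltnW pN).
apply: le_trans (lerD (lerD (lerD p2 p1) (lexx _)) (lexx _)) _; rewrite -/h.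
have P0 : 0 < p.+1%:R :> R by rewrite ltr0n.
have le1 : K * h ^+ 2 / N%:R / p.+2%:R <= K * h ^+ 2 / N%:R / p.+1%:R.
  rewrite ler_wpM2l ?lef_pV2 ?posrE ?ltr0n ?ler_nat //.
  by rewrite !mulr_ge0 ?invr_ge0 ?exprn_ge0 ?(le_trans _ h1).
have le2 : 4 * C / (p.+1%:R * N%:R) <= 4 * C * h ^+ 2 / N%:R / p.+1%:R.
  rewrite invfM [_^-1 * _^-1]mulrC mulrA ler_wpM2r ?invr_ge0 // ler_wpM2r ?invr_ge0 ?(ltW N0) //.
  by rewrite ler_peMr // mulr_ge0.
apply: le_trans (lerD (lerD (lerD (lexx _) le1) le2) le2) _.
by rewrite le_eqVlt; apply/orP; left; apply/eqP; ring.
Qed.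

(** Each dyadic block contributes at most [1]. *)
Lemma harm_pow2 L : harm (2 ^ L) <= L%:R.
Proof.
elim: L => [|L IH]; first by rewrite /harm big_geq.
have le2 : (2 ^ L <= 2 ^ L.+1)%N by rewrite leq_exp2l.
rewrite /harm (@big_cat_nat _ _ _ (2 ^ L)) ?expn_gt0 //= -natr1; apply: lerD => //.
apply: (@le_trans _ _ (\sum_(2 ^ L <= j < 2 ^ L.+1) (2 ^ L)%:R^-1)).
  apply: ler_sum_nat => j /andP[jL _].
  by rewrite lef_pV2 ?posrE ?ltr0n ?ler_nat ?expn_gt0 // (leq_trans _ jL) ?expn_gt0.
by rewrite sumr_const_nat expnS mul2n -addnn addnK -[_ *+ _]mulr_natr mulVf ?pnatr_eq0 ?expn_eq0 //.
Qed.

(** The constant covers [L <= 7]; from [L = 8] on, [L^5] grows by less than a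
    factor [2] at each step. *)
Lemma pow5_le L : (L ^ 5 <= 1024 * 2 ^ L)%N.
Proof.
have [L7|] := leqP L 7; first by do 8 (case: L L7 => [|L] L7 //).
elim: L => // L IH; rewrite ltnS leq_eqVlt => /orP[/eqP<- //|L8].
have := IH L8; rewrite [(2 ^ L.+1)%N]expnS !expnS expn0; nia.
Qed.

End Truncated.

(** * Passage to the limit *)

Section Limit.
Variable R : realType.
Implicit Types (k : seq nat) (lo N L : nat).

Definition mzv_term k (n : (size k).-tuple nat) : R :=
  \prod_(i < size k) ((tnth n i)%:R ^+ nth 0%N k i)^-1.

Lemma mzv_term_ge0 k (n : (size k).-tuple nat) : 0 <= mzv_term n.
Proof. by apply: prodr_ge0 => i _; exact: exprVn_ge0. Qed.

(** The scalar [c] absorbs the factors of the indices already summed, so that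
    the induction needs no rule for scaling infinite sums. *)
Lemma esum_mhs k lo N (c : R) : 0 <= c ->
  \esum_(n in [set n : (size k).-tuple nat | path ltn lo n && all (gtn N) n])
    (c * mzv_term n)%:E = (c * mhs R k lo N)%:E.
Proof.
elim: k lo c => [|e k IH] lo c c0.
  rewrite (_ : [set n | _] = [set [tuple]]); last first.
    by apply/seteqP; split=> n /=; rewrite (tuple0 n).
  by rewrite esum_set1 ?/mzv_term big_ord0 // lee_fin mulr1.
pose J j := [set n : (size k).-tuple nat | path ltn j n && all (gtn N) n].
pose I := [set` index_iota lo.+1 N].
(* A nonempty chain is its first index followed by a chain above that index. *)
have bij : set_bij (I `*`` J)
    [set n : (size (e :: k)).-tuple nat | path ltn lo n && all (gtn N) n]
    (fun z : nat * (size k).-tuple nat => [tuple of z.1 :: z.2]).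
  split=> [[j n]|[j n] [j' n'] _ _|n] /=.
  - rewrite /I /J /= mem_index_iota => -[/andP[-> ->]] /andP[-> ->] //.
  - by move=> /(congr1 val) /= [-> /val_inj ->].
  - case/tupleP: n => j n /= /andP[/andP[loj pn] /andP[jN nN]].
    exists (j, n) => //=; rewrite /I /J /= mem_index_iota loj jN; split=> //.
    by rewrite pn.
rewrite (@reindex_esum _ _ _ _ _ _ _ bij) -(@esum_esum _ _ _ I J (fun j (n : (size k).-tuple nat) =>
   (c * mzv_term (k := e :: k) [tuple of j :: n])%:E)); last first.
  by move=> j n _ _; rewrite lee_fin mulr_ge0 ?mzv_term_ge0.
have E j (n : (size k).-tuple nat) : c * mzv_term (k := e :: k) [tuple of j :: n] =
    c * j%:R ^- e * mzv_term n.
  rewrite /mzv_term /= big_ord_recl mulrA; congr (_ * _ * _).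
  by apply: eq_bigr => i _; rewrite tnthS.
under eq_esum => j _.
  under eq_esum => n _ do rewrite E.
  rewrite IH; last by rewrite mulr_ge0 ?exprVn_ge0.
  over.
have finI : finite_set I by exact: finite_seq.
rewrite esum_fset //; last first.
  by move=> j _; rewrite lee_fin mulr_ge0 ?mhs_ge0 // mulr_ge0 ?exprVn_ge0.
rewrite /I -fsbig_seq ?iota_uniq //= sumEFin mulr_sumr.
by congr (_%:E); apply: eq_bigr => j _; rewrite mulrA.
Qed.

(** A finite set of chains lies below some [2^L], so the infinite sum is the
    supremum of the truncated ones. *)
Lemma mhs_cvg k (B : R) : (forall N, mhs R k 0 N <= B) ->
  mhs R k 0 (2 ^ L) @[L --> \oo] --> mzv R k.
Proof.
move=> kB; set u := fun L => mhs R k 0 (2 ^ L).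
(* [E] is the sum in the definition of [mzv]; [lower] and [upper] identify it
   with the supremum of the truncated sums. *)
pose S := [set n : (size k).-tuple nat | path ltn 0%N n].
pose E := (\esum_(n in S) (mzv_term n)%:E)%E.
have restr N : \esum_(n in [set n : (size k).-tuple nat | path ltn 0%N n && all (gtn N) n])
    (mzv_term n)%:E = (mhs R k 0 N)%:E.
  rewrite -[mhs _ _ _ _]mul1r -esum_mhs //.
  by apply: eq_esum => n _; rewrite mul1r.
have lower N : ((mhs R k 0 N)%:E <= E)%E.
  rewrite -restr; apply: ge_ereal_sup => _ [X [finX XS] <-].
  apply: ereal_sup_ubound; exists X => //; split=> // n /XS /=.
  by case/andP.
have upper b : (forall L, u L <= b) -> (E <= b%:E)%E.
  move=> ub; apply: ge_ereal_sup => _ [X [finX XS] <-].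
  have /finite_seqP[r Xr] := finX.
  pose L := (\max_(n <- r) \max_(j <- n) j).+1.
  apply: (@le_trans _ _ (mhs R k 0 (2 ^ L))%:E); last by rewrite lee_fin; exact: ub.
  rewrite -restr; apply: ereal_sup_ubound; exists X => //; split=> // n Xn /=.
  rewrite XS //=; apply/allP => j jn /=.
  apply: (@leq_ltn_trans L.-1); last by rewrite (leq_trans (ltn_expl _ (ltnSn 1))) // leq_exp2l.
  rewrite /L /=; apply: (@leq_trans (\max_(j <- n) j)).
    exact: (@leq_bigmax_seq _ _ xpredT id).
  apply: (@leq_bigmax_seq _ r xpredT (fun n : (size k).-tuple nat => \max_(j <- n) j)) => //.
  by move: Xn; rewrite Xr.
have EB : (E <= B%:E)%E by apply: upper => L; exact: kB.
have Ez : E = (mzv R k)%:E.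
  rewrite /mzv fineK // ge0_fin_numE ?(le_lt_trans EB) ?ltry //.
  by apply: esum_ge0 => n _; rewrite lee_fin mzv_term_ge0.
have undec : nondecreasing_seq u.
  by move=> L L' LL'; apply: mhs_homo; rewrite leq_exp2l.
have uz L : u L <= mzv R k by rewrite -lee_fin -Ez; exact: lower.
have uub : has_ubound (range u) by exists (mzv R k) => _ [L _ <-].
have -> : mzv R k = sup (range u).
  apply/eqP; rewrite eq_le -lee_fin -Ez upper => [|L].
    by apply: ge_sup; [exists (u 0%N), 0%N | move=> _ [L _ <-]].
  by apply: ub_le_sup => //; exists L.
exact: nondecreasing_cvgn.
Qed.

(** Along [N = 2^L] the bound is [O (L^4 / 2^L) = O (1 / L)]. *)
Lemma discrepancy_small (u : nat -> R) (K : R) : 0 <= K ->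
  (forall N, (1 < N)%N -> `|u N| <= K * harm R N ^+ 4 / N%:R) ->
  u (2 ^ L)%N @[L --> \oo] --> 0.
Proof.
move=> K0 Ku; rewrite -cvg_shiftS.
have bnd L : `|u (2 ^ L.+1)%N| <= K * 1024 * harmonic L.
  apply: le_trans (Ku _ _) _; first by rewrite -[1%N]/(2 ^ 0)%N ltn_exp2l.
  rewrite -[leLHS]mulrA -[leRHS]mulrA ler_wpM2l //.
  rewrite ler_pdivrMr ?ltr0n ?expn_gt0 //.
  apply: (@le_trans _ _ (L.+1%:R ^+ 4)).
    by rewrite lerXn2r ?nnegrE ?harm_ge0 ?harm_pow2.
  rewrite mulrAC ler_pdivlMr ?ltr0n // -exprSr -natrX -natrM ler_nat.
  exact: pow5_le.
have lim0 : K * 1024 * harmonic L @[L --> \oo] --> (0 : R).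
  by rewrite -(mulr0 (K * 1024)); apply: cvgMr; exact: cvg_harmonic.
apply/norm_cvg0P; apply: squeeze_cvgr (cvg_cst 0) lim0.
by apply: nearW => L; rewrite normr_ge0 /=.
Qed.

End Limit.

Theorem theorem1 (R : realType) (m s n : nat) (hm : (1 <= m)%N) (hs : (1 <= s)%N) :
  mzv R (nseq (m - 1) 2%N ++ [:: 3%N] ++ nseq n 2%N ++ [:: 1%N] ++ nseq s 2%N) =
    mzv R (nseq (n + m + s + 1) 2%N)
    + mzv R (nseq (s - 1) 2%N ++ [:: 3%N] ++ nseq (m - 1) 2%N ++ [:: 3%N] ++ nseq n 2%N)
    + mzv R (nseq (m - 1) 2%N ++ [:: 3%N] ++ nseq (s - 1) 2%N ++ [:: 3%N] ++ nseq n 2%N).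
Proof.
case: m s hm hs => [|m] [|s] // _ _; rewrite !subn1 /=.
have -> : nseq (n + m.+1 + s.+1 + 1) 2%N =
    nseq m 2%N ++ 2%N :: nseq n 2%N ++ 2%N :: nseq s.+1 2%N.
  by rewrite !nseq_cat_cons; congr nseq; lia.
have cvg2 k : all (leq 2) k -> mhs R k 0 (2 ^ L) @[L --> \oo] --> mzv R k.
  by move=> k2; apply: (mhs_cvg (B := 2 ^+ size k)) => N; exact: mhs_le.
have cZ : mhs R (nseq m 2%N ++ 2%N :: nseq n 2%N ++ 2%N :: nseq s.+1 2%N) 0 (2 ^ L)
    @[L --> \oo] --> mzv R (nseq m 2%N ++ 2%N :: nseq n 2%N ++ 2%N :: nseq s.+1 2%N).
  by apply: cvg2; rewrite all_cat /= all_cat /= !all_twos.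
have cR i j : mhs R (nseq i 2%N ++ 3%N :: nseq j 2%N ++ 3%N :: nseq n 2%N) 0 (2 ^ L)
    @[L --> \oo] --> mzv R (nseq i 2%N ++ 3%N :: nseq j 2%N ++ 3%N :: nseq n 2%N).
  by apply: cvg2; rewrite all_cat /= all_cat /= !all_twos.
have cA : mhs R (nseq m 2%N ++ 3%N :: nseq n 2%N ++ 1%N :: nseq s.+1 2%N) 0 (2 ^ L)
    @[L --> \oo] --> mzv R (nseq m 2%N ++ 3%N :: nseq n 2%N ++ 1%N :: nseq s.+1 2%N).
  apply: mhs_cvg => N; apply: mhs_cat_le => [|a]; first exact: all_twos.
  rewrite -cat_cons; apply: mhs_cat_le => [|d]; first by rewrite /= all_twos.
  exact: mhs_one_twos_le.
have [K K0 HK] := coef_discrepancy R m s n.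
have disc0 := discrepancy_small K0 HK.
have E := cvg_unique (@Rhausdorff R) disc0
  (cvgB (cvgB (cvgB cA cZ) (cR m s)) (cR s m)).
by apply/eqP; rewrite -subr_eq0; apply/eqP; rewrite [RHS]E; ring.
Qed.
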